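(* Let $(X,d,\mu)$ be a metric measure space with $(X,d)$ connected, compact and containing more than one point. Suppose $\mu$ is variable Ahlfors $\alpha$-regular, where $\alpha$ is the local Hausdorff dimension of $X$. Then the local time exponent $\beta$ satisfies $\beta(x)\ge2$ for all $x\in X$.
   Context: $\mu$ is a finite non-negative Borel measure on $X$ of full support; $B_r(x)$ is the open ball of radius $r$ about $x$. Local dimension: $\alpha(x)=\inf\{\dim(U): U\text{ an open neighborhood of }x\}$, where $\dim$ is Hausdorff dimension. Variable Ahlfors regularity: for a bounded function $Q:X\to(0,\infty)$, $\mu$ is variable Ahlfors $Q$-regular if there is a constant $C>1$ with $\frac1C\mu(B_r(x))\le r^{Q(x)}\le C\mu(B_r(x))$ for all $x\in X$ and $0<r\le\operatorname{diam}(X)$. Local time exponent: for $r>0$ let $p_r(x,y)=\frac{1}{\mu(B_r(x))}\chi_{B_r(x)}(y)$, and let $(Y(r)_k)_{k\ge0}$ be the discrete time Markov chain on $X$ with transition kernel $p_r(x,y)\,d\mu(y)$. For a ball $B$ let $E_{r,B}(x)=\mathbb E^x[\inf\{k\ge0:Y(r)_k\notin B\}]$ and $E^+_{r,B}=\sup_{y\in B}E_{r,B}(y)$ (values in $[0,\infty]$). For $\gamma>0$ let $T_\gamma(B)=\limsup_{r\to0^+}E^+_{r,B}\,r^\gamma$, and let $\beta(B)=\sup\{\gamma:T_\gamma(B)=\infty\}=\inf\{\gamma:T_\gamma(B)=0\}\in[0,\infty]$ (with $\sup\emptyset=0$, $\inf\emptyset=\infty$). Then $\beta(x)=\inf_{R>0}\beta(B_R(x))$.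 *)

(* Defs.v *)
From HB Require Import structures.
From mathcomp Require Import all_boot all_order all_algebra.
From mathcomp Require Import all_classical all_reals all_analysis.

Set Implicit Arguments.
Unset Strict Implicit.
Unset Printing Implicit Defensive.

Import Order.TTheory GRing.Theory Num.Theory.
Import numFieldNormedType.Exports.

Local Open Scope classical_set_scope.
Local Open Scope ring_scope.
Local Open Scope ereal_scope.

(* [measurableType] is a structure on pointed types, so Borel sigma-algebras
   are only available on pointed spaces; the base point is not used otherwise. *)
#[short(type="pointedMetricType")]
HB.structure Definition PointedMetric (K : numDomainType) :=
  {M of Metric K M & Pointed M}.

Section metric_dimension.
Context {R : realType} {X : pointedMetricType R}.
Implicit Types (A : set X) (s delta : R) (x : X).

Definition borel : measurableType (sigma_display (@open X)) :=
  g_sigma_algebraType (@open X).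

(* The element 0 only matters for A = set0, whose supremum would be -oo. *)
Definition diam A : \bar R :=
  ereal_sup ([set 0] `|` [set (mdist a b)%:E | a in A & b in A]).

Definition hausdorff_content s delta A : \bar R :=
  ereal_inf [set \sum_(0 <= i <oo) poweR (diam (U i)) s |
    U in [set U : (set X)^nat |
            A `<=` \bigcup_i U i /\ forall i, diam (U i) <= delta%:E]].

Definition hausdorff_measure s A : \bar R :=
  ereal_sup [set hausdorff_content s delta A | delta in [set d : R | (0 < d)%R]].

(* Exponents are restricted to s > 0, where diam(set0)^s = 0; this does not
   change the infimum, and avoids the convention 0^0 = 1 of [poweR]. *)
Definition hausdorff_dim A : \bar R :=
  ereal_inf [set s%:E |
    s in [set s : R | (0 < s)%R /\ hausdorff_measure s A = 0]].

Definition local_dim x : \bar R :=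
  ereal_inf [set hausdorff_dim U | U in open_nbhs x].

End metric_dimension.

Arguments borel {R} X.

Section ahlfors.
Context {R : realType} {X : pointedMetricType R}.
Variable mu : set (borel X) -> \bar R.

Definition full_support :=
  forall U : set X, open U -> U !=set0 -> 0 < mu U.

Definition variable_ahlfors_regular (Q : X -> R) :=
  [/\ forall x, (0 < Q x)%R,
      exists M : R, forall x, (Q x <= M)%R &
      exists2 C : R, (1 < C)%R &
        forall (x : X) (r : R), (0 < r)%R -> r%:E <= diam [set: X] ->
          (C^-1)%:E * mu (ball x r) <= (r `^ Q x)%:E /\
          (r `^ Q x)%:E <= C%:E * mu (ball x r)].

End ahlfors.

Section markov_chain.
Context {R : realType} {X : pointedMetricType R}.

(* An X-valued process on a measurable space carrying one probability measure
   P^x for each starting point x. *)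
Record process := Process {
  process_display : measure_display ;
  sample : measurableType process_display ;
  start_at : X -> probability sample R ;
  state : nat -> sample -> X }.

Definition history (Y : process) (n : nat) : set (set (sample Y)) :=
  <<s \bigcup_(i in [set i : nat | (i <= n)%N])
        preimage_set_system [set: sample Y] (@state Y i)
          (@measurable _ (borel X)) >>.

(* The last condition is P^x(Y_{n+1} \in A | Y_0, ..., Y_n) = K(Y_n, A) a.s.,
   with the conditional probability unfolded to its defining property. *)
Definition markov_chain (K : X -> set X -> \bar R) (Y : process) :=
  [/\ forall k, measurable_fun [set: sample Y]
                  (@state Y k : sample Y -> borel X),
      forall x, @start_at Y x [set w | @state Y 0%N w = x] = 1 &
      forall (x : X) (n : nat) (C : set (sample Y)) (A : set (borel X)),
        history n C -> measurable A ->
        @start_at Y x (C `&` (@state Y n.+1 @^-1` A)) =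
          \int[@start_at Y x]_(w in C) K (@state Y n w) A].

Definition exit_time (Y : process) (B : set X) (w : sample Y) : \bar R :=
  ereal_inf [set (k%:R)%:E | k in [set k : nat | ~ B (@state Y k w)]].

Definition mean_exit_time (Y : process) (B : set X) (x : X) : \bar R :=
  \int[@start_at Y x]_w exit_time B w.

Definition max_mean_exit_time (Y : process) (B : set X) : \bar R :=
  ereal_sup [set mean_exit_time Y B y | y in B].

End markov_chain.

Arguments process {R} X.

Section time_exponent.
Context {R : realType} {X : pointedMetricType R}.

Definition walk_density (mu : set (borel X) -> \bar R) (r : R) (x y : X)
    : \bar R :=
  ((fine (mu (ball x r)))^-1 * \1_(ball x r) y)%:E.

Definition walk_kernel (mu : {finite_measure set (borel X) -> \bar R})
    (r : R) (x : X) (A : set X) : \bar R :=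
  \int[mu]_(y in (A : set (borel X))) walk_density mu r x y.

Definition scaled_exit_time (Y : R -> process X) (gamma : R) (B : set X)
    : \bar R :=
  limf_esup (fun r : R => max_mean_exit_time (Y r) B * (r `^ gamma)%:E) 0^'+.

(* Adjoining 0 implements the convention sup set0 = 0. *)
Definition time_exponent (Y : R -> process X) (B : set X) : \bar R :=
  ereal_sup ([set 0] `|`
    [set gamma%:E |
      gamma in [set g : R | (0 < g)%R /\ scaled_exit_time Y g B = +oo]]).

Definition local_time_exponent (Y : R -> process X) (x : X) : \bar R :=
  ereal_inf [set time_exponent Y (ball x rho) |
    rho in [set rho : R | (0 < rho)%R]].

End time_exponent.

(* Main.v *)
Require Import Defs.
From mathcomp Require Import all_boot all_order all_algebra.
From mathcomp Require Import all_classical all_reals all_analysis.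
From mathcomp Require Import measurable_realfun ring lra.
Import Order.TTheory GRing.Theory Num.Theory.
Import numFieldNormedType.Exports.
Local Open Scope classical_set_scope.
Local Open Scope ring_scope.

Set Implicit Arguments.
Unset Strict Implicit.
Unset Printing Implicit Defensive.

(** The kernel [p_r(x,y) = 1_{d(x,y) < r} / mu(B_r(x))] is reversible with
respect to [deg(x) dmu(x)], where [deg(x) = mu(B_r(x))], so the exit time from
a ball [B] can be bounded below by an energy estimate. Let [u_n(x)] be the
probability that the walk started at [x] is in [B] at times [0, ..., n], and
[v_N = u_0 + ... + u_(N-1)]. Then [v_N] vanishes off [B], is bounded by the
largest mean exit time [M], and solves the Poisson equation
[deg v_N - S v_N = deg (1 - u_N)] on [B], where [S f(x)] is the integral of [f]
over [B_r(x)]. Since [u_n] is nonincreasing in [n], [N u_N <= v_N <= M], and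
[u_N <= 1/2] as soon as [N >= 2M]. Write [E(f, g)] for the double integral of
[1_{d(x,y) < r} (f(x) - f(y)) (g(x) - g(y))]. By the Green formula
[energyE], for a nonnegative [f] supported in [B],
[[
  E(f, v_N) >= \int f deg    and    E(v_N, v_N) <= 2 M \int_B deg,
]]
so positivity of [E] at [f - t v_N] for the best [t] gives
[[
  (\int f deg)^2 <= 2 M (\int_B deg) E(f, f)      (occupation_energy_bound).
]]
For [f] the tent of height and radius [rho] over [B], a [1]-Lipschitz function,
[E(f, f) <= 2 r^2 \int_B deg]. Hence [M] is at least of order
[(inf_{B/2} deg / sup_B deg)^2 r^(-2)] with constants depending only on [B]
(ball_occupation_energy_bound).

Ahlfors regularity makes [deg(x)] comparable to [r^alpha(x)], so the ratio of
degrees costs a factor [r^eps] if [alpha] oscillates by at most [eps] on the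
ball. A ball of this kind lies in every ball: the local dimension is bounded
below and upper semicontinuous by its definition as an infimum over
neighbourhoods, so around a point where [alpha] is within [eps] of its infimum
over the given ball it stays within [eps] of it (small_oscillation_ball).
Exit times increase with the set, so for every ball [B], every [eps > 0] and
all small [r], the largest mean exit time from [B] is at least
[c r^(2 eps - 2)], and its product with [r^gamma] is unbounded for every
[gamma < 2 - 2 eps].

The probabilistic input is [alive_survival]: [u_n] is the [n]-th iterate of the
killed kernel on [1_B]. The Markov property is only given forward in time and
on sets; it is extended to functions by approximation with simple functions
([weighted_integral_transfer]), after which one step of the walk is traded for
one application of the kernel. *)

(** * Bounded measurable functions and double integrals *)

Section bounded_measurable.
Context {R : realType}.

Definition bounded_measurable d (T : measurableType d) (f : T -> R) :=
  measurable_fun [set: T] f /\ exists M, forall x, `|f x| <= M.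

Context {d} {T : measurableType d}.
Implicit Types f g : T -> R.

Lemma bounded_measurable_cst (c : R) : bounded_measurable (fun _ : T => c).
Proof. by split; [exact: measurable_cst | exists `|c|]. Qed.

Lemma bounded_measurable_indic (A : set T) :
  measurable A -> bounded_measurable (\1_A : T -> R).
Proof.
move=> mA; split; first exact: measurable_indic.
by exists 1 => x; rewrite indicE; case: (_ \in _); rewrite ?normr1 ?normr0.
Qed.

Lemma bounded_measurableD f g : bounded_measurable f ->
  bounded_measurable g -> bounded_measurable (fun x => f x + g x).
Proof.
move=> [mf [M fM]] [mg [N gN]]; split; first exact: measurable_funD.
by exists (M + N) => x; rewrite (le_trans (ler_normD _ _))// lerD.
Qed.

Lemma bounded_measurableB f g : bounded_measurable f ->
  bounded_measurable g -> bounded_measurable (fun x => f x - g x).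
Proof.
move=> [mf [M fM]] [mg [N gN]]; split; first exact: measurable_funB.
by exists (M + N) => x; rewrite (le_trans (ler_normB _ _))// lerD.
Qed.

Lemma bounded_measurableM f g : bounded_measurable f ->
  bounded_measurable g -> bounded_measurable (fun x => f x * g x).
Proof.
move=> [mf [M fM]] [mg [N gN]]; split; first exact: measurable_funM.
by exists (M * N) => x; rewrite normrM ler_pM.
Qed.

Lemma bounded_measurable_sum (F : nat -> T -> R) N :
  (forall n, bounded_measurable (F n)) ->
  bounded_measurable (fun x => \sum_(n < N) F n x).
Proof.
move=> bF; elim: N => [|N IH].
  under [X in bounded_measurable X]eq_fun do rewrite big_ord0.
  exact: bounded_measurable_cst.
under [X in bounded_measurable X]eq_fun do rewrite big_ord_recr/=.
exact: bounded_measurableD.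
Qed.

Lemma bounded_measurable_comp d' (T' : measurableType d') (f : T -> R)
    (h : T' -> T) : measurable_fun setT h ->
  bounded_measurable f -> bounded_measurable (fun x => f (h x)).
Proof.
move=> mh [mf [M fM]]; split; first exact: measurableT_comp.
by exists M.
Qed.

Lemma bounded_measurable_integrable (mu : {finite_measure set T -> \bar R}) f :
  bounded_measurable f -> mu.-integrable setT (EFin \o f).
Proof.
move=> [mf [M fM]]; apply: measurable_bounded_integrable => //.
  by rewrite -ge0_fin_numE// fin_num_measure.
by exists M; split; [exact: num_real | move=> x Mx y _ /=; exact: (le_trans (fM y) (ltW Mx))].
Qed.

End bounded_measurable.

Section double_integral.
Context {R : realType} {d} {T : measurableType d}.
Context (mu : {finite_measure set T -> \bar R}).
Implicit Types h : T * T -> R.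

Lemma bounded_measurable_section h x :
  bounded_measurable h -> bounded_measurable (fun y => h (x, y)).
Proof. by apply: bounded_measurable_comp; exact: pair1_measurable. Qed.

Lemma bounded_measurable_swap h :
  bounded_measurable h -> bounded_measurable (fun z => h (z.2, z.1)).
Proof. by apply: bounded_measurable_comp; exact: measurable_swap. Qed.

Lemma prod_integrable h : bounded_measurable h ->
  (mu \x mu)%E.-integrable setT (EFin \o h).
Proof.
move=> bh; have [mh [M hM]] := bh.
apply/integrable12ltyP; first exact/measurable_EFinP.
have M0 : 0 <= M by rewrite (le_trans _ (hM (point, point))).
apply: (@le_lt_trans _ _ (\int[mu]_x \int[mu]_y (cst M%:E) y)%E).
  apply: ge0_le_integral => //.
  - by move=> x _; exact: integral_ge0.
  - apply: (@measurable_fun_fubini_tonelli_F _ _ _ _ _ mu (abse \o (EFin \o h))).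
      by apply/measurableT_comp => //; exact/measurable_EFinP.
    by move=> z; rewrite /= lee_fin.
  - move=> x _; apply: ge0_le_integral => //.
    + apply/measurableT_comp => //; apply/measurable_EFinP.
      by have [] := bounded_measurable_section x bh.
    + by move=> y _; rewrite lee_fin.
have muT : mu setT \is a fin_num by exact: fin_num_measure.
under eq_integral do rewrite integral_cst//.
rewrite integral_cst//= -(fineK muT) -!EFinM ltry//.
Qed.

Lemma double_Rintegral h : bounded_measurable h ->
  \int[mu]_x \int[mu]_y h (x, y) = fine (\int[mu \x mu]_z (h z)%:E)%E.
Proof.
move=> bh; rewrite -integral12_prod_meas1; last exact: prod_integrable.
congr fine; apply: eq_integral => x _; rewrite fineK//.
apply: integrable_fin_num => //.
exact: (bounded_measurable_integrable mu (bounded_measurable_section x bh)).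
Qed.

Lemma double_RintegralD h k : bounded_measurable h -> bounded_measurable k ->
  \int[mu]_x \int[mu]_y (h (x, y) + k (x, y)) =
  \int[mu]_x \int[mu]_y h (x, y) + \int[mu]_x \int[mu]_y k (x, y).
Proof.
move=> bh bk; rewrite !double_Rintegral//.
rewrite (double_Rintegral (bounded_measurableD bh bk)).
have ih := prod_integrable bh; have ik := prod_integrable bk.
exact: (RintegralD (mu := (mu \x mu)%E) measurableT ih ik).
Qed.

Lemma double_RintegralZ (a : R) h : bounded_measurable h ->
  \int[mu]_x \int[mu]_y (a * h (x, y)) = a * \int[mu]_x \int[mu]_y h (x, y).
Proof.
move=> bh; rewrite double_Rintegral//.
rewrite (double_Rintegral (bounded_measurableM (bounded_measurable_cst a) bh)).
exact: (RintegralZl (mu := (mu \x mu)%E) a measurableT (prod_integrable bh)).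
Qed.

Lemma double_Rintegral_swap h : bounded_measurable h ->
  \int[mu]_x \int[mu]_y h (y, x) = \int[mu]_x \int[mu]_y h (x, y).
Proof.
move=> bh; rewrite double_Rintegral// -integral21_prod_meas1; last exact: prod_integrable.
congr fine; apply: eq_integral => x _; rewrite fineK//.
apply: integrable_fin_num => //.
exact: (bounded_measurable_integrable mu
  (bounded_measurable_section x (bounded_measurable_swap bh))).
Qed.

Lemma bounded_measurable_Rintegral h : bounded_measurable h ->
  bounded_measurable (fun x => \int[mu]_y h (x, y)).
Proof.
move=> bh; have bhx x := bounded_measurable_integrable mu (bounded_measurable_section x bh).
have [mh [M hM]] := bh; split.
  have := measurable_fubini_F (prod_integrable bh).
  move=> /(measurableT_comp (@fine_measurable R _ measurableT)).
  exact.
exists (M * fine (mu setT)) => x; rewrite (le_trans (le_normr_Rintegral _ (bhx x)))//.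
rewrite -(Rintegral_cst mu measurableT M).
apply: le_Rintegral => //.
  exact: integrable_norm.
exact: finite_measure_integrable_cst.
Qed.

End double_integral.

(** * Dirichlet form and killed walk of a symmetric relation *)

Lemma le_of_quadratic (R : realDomainType) (p q w E : R) :
  p <= q -> w <= p -> 0 <= E - 2 * q + w -> p <= E.
Proof. lra. Qed.

Section symmetric_relation.
Context {R : realType} {d} {T : measurableType d}.
Context (mu : {finite_measure set T -> \bar R}) (W : set (T * T)).
Context (mW : measurable W) (symW : forall x y, W (x, y) -> W (y, x)).
Implicit Types f g : T -> R.

Definition neighbour_sum f x : R := \int[mu]_y (\1_W (x, y) * f y).

Definition degree : T -> R := neighbour_sum (fun=> 1).

Definition energy f g : R :=
  \int[mu]_x \int[mu]_y (\1_W (x, y) * ((f x - f y) * (g x - g y))).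

Let bfst f : bounded_measurable f -> bounded_measurable (fun z : T * T => f z.1).
Proof. by apply: bounded_measurable_comp; exact: measurable_fst. Qed.

Let bsnd f : bounded_measurable f -> bounded_measurable (fun z : T * T => f z.2).
Proof. by apply: bounded_measurable_comp; exact: measurable_snd. Qed.

Let bW : bounded_measurable (\1_W : T * T -> R).
Proof. exact: bounded_measurable_indic. Qed.

Lemma indic_sym x y : \1_W (x, y) = \1_W (y, x) :> R.
Proof.
by rewrite !indicE; congr (_%:R); congr nat_of_bool; apply/idP/idP; rewrite !inE; exact: symW.
Qed.

Lemma bounded_measurable_neighbour f x : bounded_measurable f ->
  bounded_measurable (fun y => \1_W (x, y) * f y).
Proof.
move=> bf; apply: (@bounded_measurable_section _ _ _ (fun z => \1_W z * f z.2)).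
exact: bounded_measurableM (bsnd bf).
Qed.

Lemma neighbour_integrable f x : bounded_measurable f ->
  mu.-integrable setT (EFin \o (fun y => \1_W (x, y) * f y)).
Proof.
by move=> bf; exact/bounded_measurable_integrable/bounded_measurable_neighbour.
Qed.

Lemma bounded_measurable_neighbour_sum f :
  bounded_measurable f -> bounded_measurable (neighbour_sum f).
Proof.
move=> bf; apply: (@bounded_measurable_Rintegral _ _ _ mu (fun z => \1_W z * f z.2)).
exact: bounded_measurableM (bsnd bf).
Qed.

Lemma bounded_measurable_degree : bounded_measurable degree.
Proof. by apply: bounded_measurable_neighbour_sum; exact: bounded_measurable_cst. Qed.

Lemma neighbour_sumZ a f x : bounded_measurable f ->
  neighbour_sum (fun y => a * f y) x = a * neighbour_sum f x.
Proof.
move=> bf; rewrite /neighbour_sum -RintegralZl//; last exact: neighbour_integrable.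
by apply: eq_Rintegral => y _; ring.
Qed.

Lemma neighbour_sumD f g x : bounded_measurable f -> bounded_measurable g ->
  neighbour_sum (fun y => f y + g y) x = neighbour_sum f x + neighbour_sum g x.
Proof.
move=> bf bg; rewrite /neighbour_sum -RintegralD//; try exact: neighbour_integrable.
by apply: eq_Rintegral => y _; ring.
Qed.

Lemma le_neighbour_sum f g x : bounded_measurable f -> bounded_measurable g ->
  (forall y, f y <= g y) -> neighbour_sum f x <= neighbour_sum g x.
Proof.
move=> bf bg fg; apply: le_Rintegral => //; try exact: neighbour_integrable.
by move=> y _; rewrite ler_wpM2l.
Qed.

(** Green's formula: exchanging the variables maps the half of the integrand
that contains [f x] to the half that contains [f y]. *)
Lemma energyE f g : bounded_measurable f -> bounded_measurable g ->
  energy f g = 2 * \int[mu]_x (f x * (degree x * g x - neighbour_sum g x)).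
Proof.
move=> bf bg.
pose h z : R := \1_W z * (f z.1 * (g z.1 - g z.2)).
have bh : bounded_measurable h.
  apply: bounded_measurableM => //; apply: bounded_measurableM; first exact: bfst.
  by apply: bounded_measurableB; [exact: bfst | exact: bsnd].
have bhs := bounded_measurable_swap bh.
have hE x : \int[mu]_y h (x, y) = f x * (degree x * g x - neighbour_sum g x).
  have b1 := bounded_measurable_neighbour x (bounded_measurable_cst (1 : R)).
  have bWg := bounded_measurable_neighbour x bg.
  have i1 := bounded_measurable_integrable mu b1.
  have ig := bounded_measurable_integrable mu bWg.
  transitivity (\int[mu]_y ((f x * g x) * (\1_W (x, y) * 1)
      - f x * (\1_W (x, y) * g y))).
    by apply: eq_Rintegral => y _; rewrite /h/=; ring.
  rewrite RintegralB//; try by apply: bounded_measurable_integrable;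
    apply: bounded_measurableM => //; exact: bounded_measurable_cst.
  by rewrite !RintegralZl// /degree /neighbour_sum; ring.
have ibx z (k : T * T -> R) : bounded_measurable k ->
    mu.-integrable setT (EFin \o (fun y => k (z, y))).
  by move=> bk; exact/bounded_measurable_integrable/bounded_measurable_section.
have ib (k : T * T -> R) : bounded_measurable k ->
    mu.-integrable setT (EFin \o (fun x => \int[mu]_y k (x, y))).
  by move=> bk; exact/bounded_measurable_integrable/bounded_measurable_Rintegral.
transitivity (\int[mu]_x (\int[mu]_y h (x, y) + \int[mu]_y h (y, x))).
  apply: eq_Rintegral => x _.
  rewrite -RintegralD//; [|exact: ibx|exact: (ibx x _ bhs)].
  by apply: eq_Rintegral => y _; rewrite /h/= (indic_sym y x); ring.
rewrite RintegralD//; [|exact: ib|exact: (ib _ bhs)].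
rewrite double_Rintegral_swap// (eq_Rintegral _ (fun x _ => hE x)).
by ring.
Qed.

Lemma energy_ge0 f : 0 <= energy f f.
Proof.
apply: Rintegral_ge0 => x _; apply: Rintegral_ge0 => y _.
by rewrite mulr_ge0// -expr2 sqr_ge0.
Qed.

Lemma energyBZ f g (t : R) : bounded_measurable f -> bounded_measurable g ->
  energy (fun x => f x - t * g x) (fun x => f x - t * g x) =
  energy f f - 2 * t * energy f g + t ^+ 2 * energy g g.
Proof.
move=> bf bg.
pose h (f g : T -> R) z : R := \1_W z * ((f z.1 - f z.2) * (g z.1 - g z.2)).
have bh f' g' : bounded_measurable f' -> bounded_measurable g' ->
    bounded_measurable (h f' g').
  move=> bf' bg'; apply: bounded_measurableM => //; apply: bounded_measurableM.
    by apply: bounded_measurableB; [exact: bfst | exact: bsnd].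
  by apply: bounded_measurableB; [exact: bfst | exact: bsnd].
have bZ a f' g' : bounded_measurable f' -> bounded_measurable g' ->
    bounded_measurable (fun z => a * h f' g' z).
  by move=> bf' bg'; apply: bounded_measurableM;
    [exact: bounded_measurable_cst | exact: bh].
transitivity (\int[mu]_x \int[mu]_y (h f f (x, y) +
    (- (2 * t) * h f g (x, y) + t ^+ 2 * h g g (x, y)))).
  by apply: eq_Rintegral => x _; apply: eq_Rintegral => y _; rewrite /h/=; ring.
rewrite (double_RintegralD mu (bh _ _ bf bf)
  (bounded_measurableD (bZ (- (2 * t)) _ _ bf bg) (bZ (t ^+ 2) _ _ bg bg))).
rewrite (double_RintegralD mu (bZ (- (2 * t)) _ _ bf bg) (bZ (t ^+ 2) _ _ bg bg)).
rewrite (double_RintegralZ mu _ (bh _ _ bf bg)) (double_RintegralZ mu _ (bh _ _ bg bg)).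
have hE f' g' : \int[mu]_x \int[mu]_y h f' g' (x, y) = energy f' g' by [].
by rewrite !hE mulNr addrA.
Qed.

Section killed_walk.
Context (B : set T) (mB : measurable B) (degB : forall x, B x -> 0 < degree x).

(** [survival n] is the [n]-th iterate, on the indicator of [B], of the walk that
jumps to a uniform neighbour and is killed outside [B]. *)
Fixpoint survival n : T -> R :=
  if n is n'.+1 then
    fun x => \1_B x * ((degree x)^-1 * neighbour_sum (survival n') x)
  else \1_B.

Lemma neighbour_sum_ge0 f x : (forall y, 0 <= f y) -> 0 <= neighbour_sum f x.
Proof. by move=> f0; apply: Rintegral_ge0 => y _; rewrite mulr_ge0. Qed.

Lemma degree_ge0 x : 0 <= degree x.
Proof. exact: neighbour_sum_ge0. Qed.

Lemma survival_ge0 n x : 0 <= survival n x.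
Proof.
elim: n x => [//|n IH] x /=.
by rewrite mulr_ge0// mulr_ge0 ?invr_ge0 ?degree_ge0// neighbour_sum_ge0.
Qed.

Lemma survival_out n x : ~ B x -> survival n x = 0.
Proof. by case: n => [|n] Bx; rewrite /= indicE memNset// mul0r. Qed.

(** On nonnegative numbers inversion is the real power of exponent [-1]. *)
Lemma measurable_inv_degree : measurable_fun setT (fun x => (degree x)^-1).
Proof.
rewrite (_ : (fun x => _) = (fun x => degree x `^ (-1))); last first.
  by apply/funext => x; rewrite powR_inv1 ?degree_ge0.
have [md _] := bounded_measurable_degree.
exact: (measurableT_comp (measurable_powR (-1)) md).
Qed.

Lemma bounded_measurable_survival n :
  bounded_measurable (survival n) /\ forall x, survival n x <= \1_B x.
Proof.
elim: n => [|n [bn le]]; first by split => //; exact: bounded_measurable_indic.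
have b1 : bounded_measurable (fun _ : T => 1 : R) by exact: bounded_measurable_cst.
have le1 x : survival n.+1 x <= \1_B x.
  have [Bx|Bx] := pselect (B x); last by rewrite survival_out.
  rewrite /= indicE mem_set// mul1r ler_pdivrMl ?degB// mulr1.
  apply: le_neighbour_sum => // y; rewrite (le_trans (le y))//.
split => //; split; last first.
  exists 1 => x; rewrite ger0_norm ?survival_ge0// (le_trans (le1 x))//.
apply: measurable_funM; first exact: measurable_indic.
apply: measurable_funM; first exact: measurable_inv_degree.
by have [] := bounded_measurable_neighbour_sum bn.
Qed.

Lemma survival_nonincreasing n x : survival n.+1 x <= survival n x.
Proof.
elim: n x => [|n IH] x; first by have [_] := bounded_measurable_survival 1; exact.
have le := le_neighbour_sum x (bounded_measurable_survival n.+1).1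
  (bounded_measurable_survival n).1 IH.
by rewrite [leRHS]/= ler_wpM2l// ler_wpM2l// invr_ge0 degree_ge0.
Qed.

(** The expected time that the killed walk spends in [B] before time [N]. *)
Definition occupation N x : R := \sum_(n < N) survival n x.

Lemma bounded_measurable_occupation N : bounded_measurable (occupation N).
Proof. by apply: bounded_measurable_sum => n; exact: (bounded_measurable_survival n).1. Qed.

Lemma neighbour_sum_occupation N x :
  neighbour_sum (occupation N) x = \sum_(n < N) neighbour_sum (survival n) x.
Proof.
elim: N => [|N IH].
  rewrite big_ord0 /neighbour_sum (eq_Rintegral _ (g := cst 0)); last first.
    by move=> y _; rewrite /occupation big_ord0 mulr0.
  by rewrite Rintegral_cst// mul0r.
rewrite big_ord_recr/= -IH -neighbour_sumD//.
- by apply: eq_Rintegral => y _; rewrite /occupation big_ord_recr.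
- exact: bounded_measurable_occupation.
- exact: (bounded_measurable_survival _).1.
Qed.

(** The sum defining [occupation] telescopes under [1 - P], with [P] the killed
kernel. *)
Lemma occupation_poisson N x : B x ->
  degree x * occupation N x - neighbour_sum (occupation N) x =
  degree x * (1 - survival N x).
Proof.
move=> Bx; rewrite neighbour_sum_occupation /occupation mulr_sumr -sumrB.
have d0 := degB Bx; have dn0 := lt0r_neq0 d0.
rewrite (eq_bigr (fun n : 'I_N => degree x * survival n x - degree x * survival n.+1 x)).
  elim: N => [|N IH]; first by rewrite big_ord0/= indicE mem_set// subrr mulr0.
  rewrite big_ord_recr IH (_ : nat_of_ord ord_max = N)//.
  by move: (survival N.+1 x) => u; rewrite [LHS]/=; ring.
by move=> n _ /=; rewrite indicE mem_set// mul1r mulrA divff// mul1r.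
Qed.

(** Monotonicity turns the bound on the sum of the survival probabilities into
decay of the last one. *)
Lemma mulrn_survival_le N x : N%:R * survival N x <= occupation N x.
Proof.
rewrite /occupation mulr_natl -[X in _ *+ X]card_ord -sumr_const.
apply: ler_sum => n _; have := ltnW (ltn_ord n).
elim: N {n}(n : nat) => [|N IH] n; first by rewrite leqn0 => /eqP ->.
rewrite leq_eqVlt => /predU1P[->//|]; rewrite ltnS => /IH.
exact/le_trans/survival_nonincreasing.
Qed.

Lemma occupation_ge0 N x : 0 <= occupation N x.
Proof. by apply: sumr_ge0 => n _; exact: survival_ge0. Qed.

Lemma occupation_out N x : ~ B x -> occupation N x = 0.
Proof. by move=> Bx; rewrite /occupation big1// => n _; exact: survival_out. Qed.

Lemma energy_occupation f N : bounded_measurable f -> (forall x, ~ B x -> f x = 0) ->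
  energy f (occupation N) = 2 * \int[mu]_x (f x * (degree x * (1 - survival N x))).
Proof.
move=> bf fB; rewrite energyE//; last exact: bounded_measurable_occupation.
congr (_ * _); apply: eq_Rintegral => x _.
have [Bx|Bx] := pselect (B x); first by rewrite occupation_poisson.
by rewrite fB// !mul0r.
Qed.

(** The variational lower bound for exit times: a large test function of small
energy forces the occupation times to be large somewhere. This is the
Cauchy-Schwarz inequality for the energy, applied to [f] and to the occupation
function at a time so late that at most half of the mass survives. *)
Lemma occupation_energy_bound f M : bounded_measurable f ->
  (forall x, 0 <= f x) -> (forall x, ~ B x -> f x = 0) ->
  0 < M -> (forall N x, B x -> occupation N x <= M) ->
  0 < \int[mu]_x (\1_B x * degree x) ->
  (\int[mu]_x (f x * degree x)) ^+ 2 <=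
    2 * M * (\int[mu]_x (\1_B x * degree x)) * energy f f.
Proof.
move=> bf f0 fB M0 occM.
set b := \int[mu]_x (\1_B x * degree x); set a := \int[mu]_x (f x * degree x).
move=> b0.
have bdeg := bounded_measurable_degree.
have [N N1 NM] : exists2 N, (0 < N)%N & 2 * M <= N%:R.
  exists (Num.truncn (2 * M)).+1 => //; exact/ltW/truncnS_gt.
(* N survival N <= M, hence at most half of the mass survives up to N *)
have u2 x : B x -> survival N x <= 2^-1.
  move=> Bx; have := le_trans (mulrn_survival_le N x) (occM N x Bx).
  have := survival_ge0 N x; nra.
have bu := (bounded_measurable_survival N).1.
have bv := bounded_measurable_occupation N.
have b1u : bounded_measurable (fun x => 1 - survival N x).
  by apply: bounded_measurableB => //; exact: bounded_measurable_cst.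
have bint g : bounded_measurable g -> mu.-integrable setT (EFin \o g).
  exact: bounded_measurable_integrable.
have afv : a <= energy f (occupation N).
  rewrite energy_occupation// -RintegralZl//; last first.
    by apply: bint; do 2 apply: bounded_measurableM => //.
  apply: le_Rintegral => //.
  - by apply: bint; exact: bounded_measurableM.
  - apply: bint; apply: bounded_measurableM; first exact: bounded_measurable_cst.
    by do 2 apply: bounded_measurableM => //.
  - move=> x _; have [Bx|Bx] := pselect (B x); last by rewrite fB// !mul0r mulr0.
    rewrite mulrCA ler_wpM2l// mulrCA ler_peMr ?degree_ge0//.
    by have := u2 x Bx; lra.
have vv : energy (occupation N) (occupation N) <= 2 * M * b.
  rewrite energy_occupation//; last by move=> x; exact: occupation_out.
  rewrite -mulrA ler_pM2l// -RintegralZl//; last first.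
    by apply: bint; apply: bounded_measurableM => //; exact: bounded_measurable_indic.
  apply: le_Rintegral => //.
  - by apply: bint; do 2 apply: bounded_measurableM => //.
  - apply: bint; apply: bounded_measurableM; first exact: bounded_measurable_cst.
    by apply: bounded_measurableM => //; exact: bounded_measurable_indic.
  - move=> x _; have [Bx|Bx] := pselect (B x); last first.
      by rewrite occupation_out// mul0r indicE memNset// mul0r mulr0.
    rewrite indicE mem_set// mul1r ler_pM ?occupation_ge0 ?occM//.
      rewrite mulr_ge0 ?degree_ge0// subr_ge0 (le_trans (u2 x Bx))//; lra.
    by rewrite ler_piMr ?degree_ge0// gerBl survival_ge0.
have a0 : 0 <= a by apply: Rintegral_ge0 => x _; rewrite mulr_ge0 ?degree_ge0.
have Mb0 : 0 < 2 * M * b by rewrite !mulr_gt0.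
(* a / (2 M b) minimizes the quadratic polynomial that bounds the energy *)
have := energy_ge0 (fun x => f x - a / (2 * M * b) * occupation N x).
rewrite energyBZ//; set t := a / _ => tE.
have t0 : 0 <= t by rewrite divr_ge0// ltW.
have ta : a = t * (2 * M * b) by rewrite /t divfK// gt_eqF.
have := ler_wpM2l t0 afv; have := ler_wpM2l (sqr_ge0 t) vv => h1 h2.
have t2 : t ^+ 2 * (2 * M * b) = t * a by rewrite ta; ring.
have h : t * a <= energy f f.
  by apply: le_of_quadratic h2 _ _; [rewrite -t2; exact: h1 | rewrite mulrA].
rewrite (_ : a ^+ 2 = 2 * M * b * (t * a)) ?ler_pM2l//.
by rewrite expr2 {1}ta; ring.
Qed.

End killed_walk.
End symmetric_relation.

(** * Walks on the balls of a compact metric space *)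

Lemma countable_bigcup_measurable d (T : measurableType d) (I : pointedType)
    (A : set I) (F : I -> set T) : countable A ->
  (forall i, A i -> measurable (F i)) -> measurable (\bigcup_(i in A) F i).
Proof.
move=> /countable_injP[f injf] mF.
have AE := injpinv_image (fun=> point) injf.
have mF' n : (f @` A) n -> measurable (F ('pinv_(fun=> point) A f n)).
  by move=> fAn; apply: mF; rewrite -[X in X _]AE; exists n.
by rewrite -AE bigcup_image; exact: bigcup_measurable.
Qed.

Section metric_borel.
Context {R : realType} {X : pointedMetricType R}.

Lemma open_metric_ball (x : X) (r : R) : open (ball x r).
Proof.
rewrite openE => y; rewrite ballEmdist/= => xy.
apply/nbhs_ballP; exists (r - mdist x y) => /=; first by rewrite subr_gt0.
move=> z; rewrite !ballEmdist/= ltrBrDl; apply: le_lt_trans.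
exact: metric_triangle.
Qed.

Lemma measurable_open (U : set X) : open U -> measurable (U : set (borel X)).
Proof. by move=> oU; exact: sub_sigma_algebra. Qed.

Lemma measurable_metric_ball (x : X) (r : R) : measurable (ball x r : set (borel X)).
Proof. by apply: measurable_open; exact: open_metric_ball. Qed.

Lemma measurable_mdist (x : X) : measurable_fun setT (mdist x : borel X -> R).
Proof.
move=> mT; apply: (measurability _ (RGenInftyO.measurableE R)) => //.
move=> _ [_ [a ->] <-]; rewrite setTI.
rewrite (_ : _ @^-1` _ = ball x a); first exact: measurable_metric_ball.
by rewrite ballEmdist; apply/seteqP; split => y /=; rewrite in_itv.
Qed.

Lemma ball_sub_ball (x y : X) (r s : R) : mdist x y + s <= r -> ball y s `<=` ball x r.
Proof.
move=> h z; rewrite !ballEmdist/= => yz.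
by have := metric_triangle x y z; lra.
Qed.

Definition close_pairs (r : R) : set (borel X * borel X) :=
  [set z | ball (z.1 : X) r (z.2 : X)].

(** By compactness the topology has a countable base, so the open set of close
pairs is a countable union of open rectangles, as the product sigma-algebra
requires. *)
Lemma measurable_close_pairs (r : R) :
  compact [set: X] -> measurable (close_pairs r).
Proof.
move=> /compact_second_countable[/= B cB [oB basisB]].
pose F (U V : set X) : set (borel X * borel X) :=
  if asbool (U `*` V `<=` close_pairs r) then U `*` V else set0.
have -> : close_pairs r = \bigcup_(U in B) \bigcup_(V in B) F U V.
  apply/seteqP; split => [[x y]|z [U _ [V _]]]; last first.
    by rewrite /F; case: asboolP => // h /h.
  rewrite /close_pairs/= ballEmdist/= => xy.
  pose e := (r - mdist x y) / 2.
  have e0 : 0 < e by rewrite divr_gt0// subr_gt0.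
  have [U [BU Ux] Ue] := basisB x (ball x e) (nbhsx_ballx x e e0).
  have [V [BV Vy] Ve] := basisB y (ball y e) (nbhsx_ballx y e e0).
  exists U => //; exists V => //.
  rewrite /F /=; case: asboolP => // -[] [x' y'] [/= /Ue xx' /Ve yy'].
  move: xx' yy'; rewrite /close_pairs/= !ballEmdist/= => xx' yy'.
  have := metric_triangle x' x y'; have := metric_triangle x y y'.
  by rewrite (metric_sym x' x); move: xx' yy'; rewrite /e; lra.
do 2 (apply: countable_bigcup_measurable => // ? ?).
rewrite /F; case: asboolP => // _.
by apply: measurableX; apply: measurable_open; exact: oB.
Qed.

Lemma close_pairs_sym r x y : close_pairs r (x, y) -> close_pairs r (y, x).
Proof. exact: ball_sym. Qed.

Lemma indic_close_pairs r (x y : X) : \1_(close_pairs r) (x, y) = \1_(ball x r) y :> R.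
Proof. by rewrite !indicE; congr (nat_of_bool _)%:R; apply/idP/idP; rewrite !inE. Qed.

Definition tent (x0 : X) (rho : R) (y : X) : R := Num.max 0 (rho - mdist x0 y).

Lemma tent_ge0 x0 rho y : 0 <= tent x0 rho y.
Proof. by rewrite le_max lexx. Qed.

Lemma tent_out x0 rho y : ~ ball x0 rho y -> tent x0 rho y = 0.
Proof.
rewrite ballEmdist/= => /negP; rewrite -leNgt => h.
by apply/max_idPl; rewrite subr_le0.
Qed.

Lemma tent_lipschitz x0 rho x y : `|tent x0 rho x - tent x0 rho y| <= mdist x y.
Proof.
have := metric_triangle x0 x y; have := metric_triangle x0 y x.
have := mdist_ge0 x y; rewrite (metric_sym y x) /tent => h1 h2 h3.
rewrite ler_norml; apply/andP; split.
  by case: (lerP 0 (rho - mdist x0 x)); case: (lerP 0 (rho - mdist x0 y)); lra.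
by case: (lerP 0 (rho - mdist x0 x)); case: (lerP 0 (rho - mdist x0 y)); lra.
Qed.

Lemma tent_half x0 rho y : ball x0 (rho / 2) y -> rho / 2 <= tent x0 rho y.
Proof. by rewrite ballEmdist/= le_max => h; apply/orP; right; lra. Qed.

Lemma bounded_measurable_tent x0 rho : bounded_measurable (tent x0 rho : borel X -> R).
Proof.
split.
  apply: measurable_maxr => //; apply: measurable_funB => //.
  exact: measurable_mdist.
exists `|rho| => y; rewrite ger0_norm ?tent_ge0// ge_max normr_ge0/=.
have := mdist_ge0 x0 y; have := ler_norm rho; lra.
Qed.

End metric_borel.

Section ball_walk_exit.
Context {R : realType} {X : pointedMetricType R}.
Context (mu : {finite_measure set (borel X) -> \bar R}).
Context (X_compact : compact [set: X]) (r : R).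
Let W : set (borel X * borel X) := close_pairs r.
Let mW : measurable W := measurable_close_pairs r X_compact.
Let symW : forall x y, W (x, y) -> W (y, x) := @close_pairs_sym R X r.
Local Notation deg := (degree mu W).

Lemma degreeE x : deg x = fine (mu (ball (x : X) r)).
Proof.
rewrite /degree /neighbour_sum /Rintegral; congr fine.
transitivity (\int[mu]_y (\1_(ball (x : X) r) y)%:E)%E.
  by apply: eq_integral => y _; rewrite mulr1 indic_close_pairs.
by rewrite integral_indic ?setIT//; exact: measurable_metric_ball.
Qed.

(** Pairs of neighbours are at distance less than [r] and the tent is
[1]-Lipschitz, so a pair contributes at most [r ^+ 2], and nothing unless one
of its members lies in the ball. *)
Lemma tent_energy_le x0 rho : 0 <= r ->
  energy mu W (tent x0 rho) (tent x0 rho) <=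
    2 * r ^+ 2 * \int[mu]_x (\1_(ball x0 rho) x * deg x).
Proof.
move=> r0; set B := ball x0 rho; set f := tent x0 rho.
have mB : measurable (B : set (borel X)) by exact: measurable_metric_ball.
have bW := bounded_measurable_indic (R := R) mW.
have bB := bounded_measurable_indic (R := R) mB.
have bf : bounded_measurable (f : borel X -> R) by exact: bounded_measurable_tent.
have bfst g : bounded_measurable g -> bounded_measurable (fun z : borel X * borel X => g z.1 : R).
  by apply: bounded_measurable_comp; exact: measurable_fst.
have bsnd g : bounded_measurable g -> bounded_measurable (fun z : borel X * borel X => g z.2 : R).
  by apply: bounded_measurable_comp; exact: measurable_snd.
pose h (z : borel X * borel X) : R := \1_W z * \1_B z.1.
have bh : bounded_measurable h.
  by apply: bounded_measurableM => //; exact: (bfst _ bB).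
have bhs := bounded_measurable_swap bh.
pose k (z : borel X * borel X) : R := \1_W z * ((f z.1 - f z.2) * (f z.1 - f z.2)).
have bk : bounded_measurable k.
  by apply: bounded_measurableM => //; apply: bounded_measurableM;
    apply: bounded_measurableB; first [exact: (bfst _ bf)|exact: (bsnd _ bf)].
have kh x y : k (x, y) <= r ^+ 2 * (h (x, y) + h (y, x)).
  rewrite /k /h/= (indic_sym symW y x) -mulrDr [leRHS]mulrCA.
  have [xy|xy] := pselect (W (x, y)); last by rewrite indicE memNset// !mul0r.
  rewrite indicE mem_set// !mul1r.
  have fr : (f x - f y) ^+ 2 <= r ^+ 2.
    rewrite -real_normK ?num_real// ler_pXn2r ?nnegrE//.
    rewrite (le_trans (tent_lipschitz _ _ _ _))//.
    by move: xy; rewrite /W /close_pairs/= ballEmdist/= => /ltW.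
  rewrite -expr2.
  have [Bx|Bx] := pselect (B x).
    rewrite (le_trans fr)// ler_peMr ?sqr_ge0// indicE mem_set// lerDl//.
  have [By|By] := pselect (B y).
    by rewrite (le_trans fr)// ler_peMr ?sqr_ge0// [X in _ + X]indicE mem_set// lerDr.
  by rewrite /f !tent_out// subrr expr0n/= mulr_ge0 ?sqr_ge0// addr_ge0.
have hE x : \int[mu]_y h (x, y) = \1_B x * deg x.
  transitivity (\int[mu]_y (\1_B x * (\1_W (x, y) * 1))).
    by apply: eq_Rintegral => y _; rewrite /h/=; ring.
  rewrite RintegralZl//.
  exact: (neighbour_integrable mu mW x (bounded_measurable_cst 1)).
have le : energy mu W f f <=
    \int[mu]_x \int[mu]_y (r ^+ 2 * (h (x, y) + h (y, x))).
  have bk' : bounded_measurable (fun z => r ^+ 2 * (h z + h (z.2, z.1))).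
    apply: bounded_measurableM; first exact: bounded_measurable_cst.
    exact: bounded_measurableD.
  apply: le_Rintegral => //.
  - exact: (bounded_measurable_integrable mu (bounded_measurable_Rintegral mu bk)).
  - exact: (bounded_measurable_integrable mu (bounded_measurable_Rintegral mu bk')).
  - move=> x _; apply: le_Rintegral => //.
    + exact: (bounded_measurable_integrable mu (bounded_measurable_section x bk)).
    + exact: (bounded_measurable_integrable mu (bounded_measurable_section x bk')).
    + by move=> y _; exact: kh.
apply: (le_trans le).
rewrite (double_RintegralZ mu (r ^+ 2) (bounded_measurableD bh bhs)).
rewrite (double_RintegralD mu bh bhs) (double_Rintegral_swap mu bh).
rewrite (eq_Rintegral _ (fun x _ => hE x)).
by rewrite le_eqVlt; apply/orP; left; apply/eqP; ring.
Qed.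

Lemma tent_mass_ge x0 rho (c : R) : 0 <= rho -> 0 <= c ->
  (forall x, ball x0 (rho / 2) x -> c <= deg x) ->
  rho / 2 * c * fine (mu (ball x0 (rho / 2))) <= \int[mu]_x (tent x0 rho x * deg x).
Proof.
move=> rho0 c0 cdeg.
have mH : measurable (ball x0 (rho / 2) : set (borel X)) by exact: measurable_metric_ball.
have bH := bounded_measurable_indic (R := R) mH.
have bdeg := bounded_measurable_degree mu mW.
rewrite -[X in mu X]setIT -integral_indic//.
rewrite -[X in _ * X]/(\int[mu]_x \1_(ball x0 (rho / 2)) x).
rewrite -RintegralZl//; last exact: bounded_measurable_integrable.
apply: le_Rintegral => //.
- apply: bounded_measurable_integrable.
  by apply: bounded_measurableM => //; exact: bounded_measurable_cst.
- apply: bounded_measurable_integrable.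
  by apply: bounded_measurableM => //; exact: bounded_measurable_tent.
move=> x _; have [Hx|Hx] := pselect (ball x0 (rho / 2) x).
  by rewrite indicE mem_set// mulr1 ler_pM ?divr_ge0 ?tent_half ?cdeg.
by rewrite indicE memNset// mulr0 mulr_ge0 ?tent_ge0 ?degree_ge0.
Qed.

Lemma degree_mass_le (B : set (borel X)) (K : R) : measurable B ->
  (forall x, B x -> deg x <= K) ->
  \int[mu]_x (\1_B x * deg x) <= K * fine (mu B).
Proof.
move=> mB degK.
have bB := bounded_measurable_indic (R := R) mB.
have bdeg := bounded_measurable_degree mu mW.
rewrite -[X in mu X]setIT -integral_indic//.
rewrite -[X in _ <= _ * X]/(\int[mu]_x \1_B x).
rewrite -RintegralZl//; last exact: bounded_measurable_integrable.
apply: le_Rintegral => //.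
- by apply: bounded_measurable_integrable; exact: bounded_measurableM.
- apply: bounded_measurable_integrable.
  by apply: bounded_measurableM => //; exact: bounded_measurable_cst.
move=> x _; have [Hx|Hx] := pselect (B x).
  by rewrite indicE mem_set// mulr1 mul1r degK.
by rewrite indicE memNset// mulr0 mul0r.
Qed.

(** [occupation_energy_bound] for the tent, whose height is at least [rho / 2] on
the concentric ball of half the radius. *)
Lemma ball_occupation_energy_bound x0 (rho k K M : R) :
  0 < r -> 0 < rho -> 0 < k -> 0 < M ->
  (forall x, ball x0 rho x -> 0 < deg x <= K) ->
  (forall x, ball x0 (rho / 2) x -> k <= deg x) ->
  (0 < mu (ball x0 (rho / 2) : set (borel X)))%E ->
  (forall N x, ball x0 rho x -> occupation mu W (ball x0 rho) N x <= M) ->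
  (rho / 2 * k * fine (mu (ball x0 (rho / 2)))) ^+ 2 <=
    4 * M * r ^+ 2 * (K * fine (mu (ball x0 rho))) ^+ 2.
Proof.
move=> r0 rho0 k0 M0 degK degk muH occM.
set B := ball x0 rho; set H := ball x0 (rho / 2).
have HB : H `<=` B by apply: ball_sub_ball; rewrite mdistxx; lra.
have mB : measurable (B : set (borel X)) by exact: measurable_metric_ball.
have mH : measurable (H : set (borel X)) by exact: measurable_metric_ball.
have degB x : B x -> 0 < deg x by move=> /degK /andP[].
set a := \int[mu]_x (tent x0 rho x * deg x).
set b := \int[mu]_x (\1_B x * deg x).
have ha : rho / 2 * k * fine (mu H) <= a by apply: tent_mass_ge => //; exact: ltW.
have fH : 0 < fine (mu H) by rewrite fine_gt0// muH ltey_eq fin_num_measure.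
have a0 : 0 < a by apply: lt_le_trans ha; rewrite !mulr_gt0// divr_gt0.
have hb : b <= K * fine (mu B) by apply: degree_mass_le => // x /degK /andP[].
have bf : bounded_measurable (tent x0 rho : borel X -> R) by exact: bounded_measurable_tent.
have b0 : 0 < b.
  have ab : a <= rho * b.
    rewrite /b -RintegralZl//; last first.
      apply: bounded_measurable_integrable; apply: bounded_measurableM.
        exact: bounded_measurable_indic.
      exact: bounded_measurable_degree.
    apply: le_Rintegral => //.
    - apply: bounded_measurable_integrable; apply: bounded_measurableM => //.
      exact: bounded_measurable_degree.
    - apply: bounded_measurable_integrable; apply: bounded_measurableM.
        exact: bounded_measurable_cst.
      apply: bounded_measurableM; first exact: bounded_measurable_indic.
      exact: bounded_measurable_degree.
    move=> x _; rewrite mulrA ler_wpM2r ?degree_ge0//.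
    have [Bx|Bx] := pselect (B x); last by rewrite tent_out// indicE memNset// mulr0.
    rewrite indicE mem_set// mulr1 ge_max (ltW rho0)/= gerBl.
    exact: mdist_ge0.
  by move: (lt_le_trans a0 ab); rewrite pmulr_rgt0.
have var := occupation_energy_bound mW symW mB degB bf (tent_ge0 x0 rho)
  (@tent_out _ _ x0 rho) M0 occM b0.
apply: (@le_trans _ _ (a ^+ 2)).
  rewrite ler_pXn2r// nnegrE; last exact: ltW.
  by rewrite !mulr_ge0// ?ltW// divr_gt0.
apply: (le_trans var).
have := tent_energy_le x0 rho (ltW r0); rewrite -/B -/b => en.
apply: (@le_trans _ _ (2 * M * b * (2 * r ^+ 2 * b))).
  by rewrite ler_wpM2l// !mulr_ge0// ltW.
rewrite (_ : 2 * M * b * _ = 4 * M * r ^+ 2 * b ^+ 2); last by ring.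
rewrite ler_wpM2l//; first by rewrite !mulr_ge0 ?sqr_ge0// ltW.
by rewrite ler_pXn2r// nnegrE ltW// (lt_le_trans b0).
Qed.

End ball_walk_exit.

(** * From the Markov property to iterated kernels *)

Section weighted_integral.
Local Open Scope ereal_scope.
Context {R : realType} {d d'} {S : measurableType d} {T : measurableType d'}.
Import HBNNSimple.

(** The right-hand side involves the weighted pushforward of [rho] only through
its values on sets. *)
Lemma weighted_integral_approx (rho : {measure set S -> \bar R}) (a : S -> R)
    (phi : S -> T) (g : T -> \bar R) (mg : measurable_fun setT g) :
  measurable_fun setT a -> (forall s, 0 <= a s)%R -> measurable_fun setT phi ->
  (forall t, 0 <= g t) ->
  let h := nnsfun_approx measurableT mg in
  \int[rho]_s ((a s)%:E * g (phi s)) =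
  limn (fun n => \sum_(y \in range (h n))
    (y%:E * \int[rho]_s (a s * \1_(h n @^-1` [set y]) (phi s))%:E)).
Proof.
move=> ma a0 mphi g0 h.
have mh n : measurable_fun setT (fun s => (h n (phi s))%:E).
  by apply/measurable_EFinP; apply: measurableT_comp mphi.
transitivity (limn (fun n => \int[rho]_s ((a s)%:E * (h n (phi s))%:E))).
  rewrite -monotone_convergence//; first last.
  - by move=> s _ m n mn; rewrite lee_wpmul2l// lee_fin//; exact/lefP/nd_nnsfun_approx.
  - by move=> n s _; rewrite mule_ge0 ?lee_fin.
  - by move=> n; apply: emeasurable_funM => //; exact/measurable_EFinP.
  apply: eq_integral => s _; apply/esym/cvg_lim => //.
  by apply: cvgeZl => //; exact: cvg_nnsfun_approx.
congr (limn _); apply/funext => n.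
have mind y : measurable_fun setT (fun s => (\1_(h n @^-1` [set y]) (phi s) : R)).
  by apply: (measurableT_comp _ mphi); exact: measurable_indic.
transitivity (\int[rho]_s \sum_(y \in range (h n))
    ((a s)%:E * (y * \1_(h n @^-1` [set y]) (phi s))%:E)).
  apply: eq_integral => s _; rewrite fimfunE -fsumEFin// ge0_mule_fsumr//.
  by move=> y; exact: nnfun_muleindic_ge0.
rewrite ge0_integral_fsum//; last 2 first.
- move=> y; apply: emeasurable_funM; apply/measurable_EFinP => //.
  exact: measurable_funM.
- by move=> y s _; apply: mule_ge0; [rewrite lee_fin|exact: nnfun_muleindic_ge0].
apply: eq_fsbigr => y /[!inE] -[t _ <-].
rewrite -ge0_integralZl//; last 3 first.
- by apply/measurable_EFinP; exact: measurable_funM.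
- by move=> s _; rewrite lee_fin mulr_ge0.
- by rewrite lee_fin.
by apply: eq_integral => s _; rewrite -!EFinM mulrCA.
Qed.

End weighted_integral.

Section weighted_integral_transfer.
Import HBNNSimple.

(** Extends an identity between two weighted pushforward measures from sets to
functions, without building these measures: both integrals are limits along
the same simple functions. *)
Lemma weighted_integral_transfer (R : realType) d1 d2 d'
    (S1 : measurableType d1) (S2 : measurableType d2) (T : measurableType d')
    (rho1 : {measure set S1 -> \bar R}) (rho2 : {measure set S2 -> \bar R})
    (a1 : S1 -> R) (a2 : S2 -> R) (phi1 : S1 -> T) (phi2 : S2 -> T) :
  measurable_fun setT a1 -> (forall s, 0 <= a1 s) -> measurable_fun setT phi1 ->
  measurable_fun setT a2 -> (forall s, 0 <= a2 s) -> measurable_fun setT phi2 ->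
  (forall A, measurable A ->
    \int[rho1]_s (a1 s * \1_A (phi1 s))%:E = \int[rho2]_s (a2 s * \1_A (phi2 s))%:E)%E ->
  forall g : T -> \bar R, measurable_fun setT g -> (forall t, 0 <= g t)%E ->
  (\int[rho1]_s ((a1 s)%:E * g (phi1 s)) = \int[rho2]_s ((a2 s)%:E * g (phi2 s)))%E.
Proof.
move=> ma1 a10 mphi1 ma2 a20 mphi2 agree g mg g0.
rewrite (weighted_integral_approx rho1 mg)// (weighted_integral_approx rho2 mg)//.
congr (limn _); apply/funext => n; apply: eq_fsbigr => y _.
by rewrite agree//.
Qed.

End weighted_integral_transfer.

(** Integrals of nonnegative functions are suprema over the simple functions
below them, so no measurability of the integrands is involved; this spares
proving that exit times are measurable. *)
Lemma ge0_le_integral_nonmeasurable d (S : measurableType d) (R : realType)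
    (rho : {measure set S -> \bar R}) (f g : S -> \bar R) :
  (forall s, 0 <= f s)%E -> (forall s, f s <= g s)%E ->
  (\int[rho]_s f s <= \int[rho]_s g s)%E.
Proof.
move=> f0 fg; rewrite !ge0_integralTE//; last first.
  by move=> s; exact: le_trans (f0 s) (fg s).
apply: ereal_sup_le => _ [h /= hf <-].
by exists h => // s; exact: le_trans (hf s) (fg s).
Qed.

Lemma integral_indicl (R : realType) d (S : measurableType d) (rho : {measure set S -> \bar R})
    (D : set S) (f : S -> \bar R) :
  (\int[rho]_(s in D) f s = \int[rho]_s ((\1_D s)%:E * f s))%E.
Proof.
rewrite integral_mkcond; apply: eq_integral => s _.
by rewrite /patch indicE; case: (s \in D); rewrite ?mul1e ?mul0e.
Qed.

Section exit_time.
Context {R : realType} {X : pointedMetricType R} (Y : process X).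
Implicit Types B : set X.

Lemma exit_time_ge0 B w : (0 <= @exit_time _ _ Y B w)%E.
Proof. by apply: le_ereal_inf_tmp => _ [k _ <-]; rewrite lee_fin. Qed.

Lemma le_max_mean_exit_time B B' : B' `<=` B ->
  (max_mean_exit_time Y B' <= max_mean_exit_time Y B)%E.
Proof.
move=> BB; apply: ge_ereal_sup => _ [y B'y <-].
apply: (@le_trans _ _ (mean_exit_time Y B y)); last first.
  by apply: ereal_sup_ubound; exists y => //; exact: BB.
apply: ge0_le_integral_nonmeasurable; first exact: exit_time_ge0.
by move=> w; apply: ereal_inf_le_tmp => _ [k /= nB <-]; exists k => //= /BB.
Qed.

End exit_time.

Section markov.
Context {R : realType} {X : pointedMetricType R}.
Context (mu : {finite_measure set (borel X) -> \bar R}).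
Context (X_compact : compact [set: X]) (r : R).
Let W : set (borel X * borel X) := close_pairs r.
Let mW : measurable W := measurable_close_pairs r X_compact.
Local Notation deg := (degree mu W).
Context (Y : process X) (Y_markov : markov_chain (walk_kernel mu r) Y).
Context (B : set X) (mB : measurable (B : set (borel X))).

Fixpoint alive n : set (sample Y) :=
  if n is n'.+1 then alive n' `&` (@state _ _ Y n'.+1 @^-1` B)
  else @state _ _ Y 0%N @^-1` B.

Lemma history_alive n : history n (alive n).
Proof.
have hist_state m k : (k <= m)%N -> history m (@state _ _ Y k @^-1` B).
  move=> km; apply: sub_sigma_algebra; exists k => //.
  by exists B => //; rewrite setTI.
elim: n => [|n IH]; first exact: hist_state.
pose T := g_sigma_algebraType (\bigcup_(i in [set i : nat | (i <= n.+1)%N])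
        preimage_set_system [set: sample Y] (@state _ _ Y i)
          (@measurable _ (borel X))).
have mhist (A : set (sample Y)) : history n.+1 A -> measurable (A : set T) by [].
rewrite -[history _ _]/(measurable (alive n.+1 : set T)).
apply: (@measurableI _ T); last exact: hist_state.
apply: sub_sigma_algebra2 IH => A [i /= lein hA].
by exists i => //=; exact: leq_trans lein _.
Qed.

Lemma alive_le m n : (m <= n)%N -> alive n `<=` alive m.
Proof.
elim: n => [|n IH]; first by rewrite leqn0 => /eqP ->.
by rewrite leq_eqVlt => /predU1P[->//|/IH sub] w [/sub].
Qed.

Lemma aliveB n w : alive n w -> B (@state _ _ Y n w).
Proof. by case: n => [|n]//= -[]. Qed.

Let mstate k : measurable_fun [set: sample Y] (@state _ _ Y k : sample Y -> borel X).
Proof. by case: Y_markov => + _ _; exact. Qed.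

Lemma measurable_alive n : measurable (alive n).
Proof.
have mS k : measurable (@state _ _ Y k @^-1` B).
  by rewrite -[X in measurable X]setTI; exact: (mstate k).
by elim: n => [|n IH] //=; exact: measurableI.
Qed.

(** Each [n] with [alive n w] precedes the exit time. *)
Lemma sum_alive_le_exit_time N w :
  ((\sum_(n < N) \1_(alive n) w)%:E <= exit_time B w)%E.
Proof.
apply: le_ereal_inf_tmp => _ [k /= nB <-]; rewrite lee_fin.
have out n : (k <= n)%N -> \1_(alive n) w = 0 :> R.
  by move=> kn; rewrite indicE memNset// => /(alive_le kn)/aliveB.
have [kN|kN] := leqP k N.
  rewrite -(subnKC kN) big_split_ord/= [X in _ + X]big1 ?addr0; last first.
    by move=> i _; rewrite out// leq_addr.
  rewrite -[leRHS]mulr_natl mulr1 -[X in X%:R]card_ord -sumr_const.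
  by apply: ler_sum.
apply: (@le_trans _ _ (\sum_(n < N) 1)); first exact: ler_sum.
by rewrite sumr_const card_ord ler_nat ltnW.
Qed.

Lemma walk_integral (g : borel X -> R) (y : X) : bounded_measurable g ->
  (\int[mu]_z (((deg y)^-1 * \1_W (y, z)) * g z)%:E)%E =
  ((deg y)^-1 * neighbour_sum mu W g y)%:E.
Proof.
move=> bg; have bcg : bounded_measurable (fun z => (deg y)^-1 * g z).
  by apply: bounded_measurableM => //; exact: bounded_measurable_cst.
rewrite -neighbour_sumZ// /neighbour_sum /Rintegral fineK; last first.
  exact: integrable_fin_num (neighbour_integrable mu mW y bcg).
by apply: eq_integral => z _; rewrite mulrCA mulrA.
Qed.

(** One step of the walk from time [n] to [n.+1], for a function supported in
[B], so that staying alive at the last step is automatic. The Markov property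
says that the law of the next state on the event [alive n] has a density, and
Tonelli's theorem integrates it out. *)
Lemma markov_step x n (g : borel X -> R) :
  bounded_measurable g -> (forall y, 0 <= g y) -> (forall y, ~ B y -> g y = 0) ->
  (\int[@start_at _ _ Y x]_(w in alive n.+1) (g (@state _ _ Y n.+1 w))%:E =
   \int[@start_at _ _ Y x]_(w in alive n)
     ((deg (@state _ _ Y n w))^-1 * neighbour_sum mu W g (@state _ _ Y n w))%:E)%E.
Proof.
move=> bg g0 gB; set P := @start_at _ _ Y x.
pose a1 w : R := \1_(alive n) w.
pose c w : R := (deg (@state _ _ Y n w))^-1.
pose a2 (s : sample Y * borel X) : R :=
  a1 s.1 * (c s.1 * \1_W (@state _ _ Y n s.1 : borel X, s.2)).
have mal := measurable_alive n.
have ma1 : measurable_fun setT a1 by exact: measurable_indic.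
have a10 w : 0 <= a1 w by [].
have mY1 : measurable_fun setT
    (fun s : sample Y * borel X => @state _ _ Y n s.1 : borel X).
  exact: measurableT_comp (mstate n) measurable_fst.
have mc : measurable_fun setT (fun s : sample Y * borel X => c s.1).
  exact: measurableT_comp (measurable_inv_degree mu mW) mY1.
have mW2 : measurable_fun setT
    (fun s : sample Y * borel X => \1_W (@state _ _ Y n s.1 : borel X, s.2) : R).
  have mp : measurable_fun setT
      (fun s : sample Y * borel X => (@state _ _ Y n s.1 : borel X, s.2)).
    exact: measurable_fun_pair mY1 measurable_snd.
  exact: measurableT_comp (measurable_indic mW) mp.
have ma2 : measurable_fun setT a2.
  apply: measurable_funM; first exact: measurableT_comp ma1 measurable_fst.
  exact: measurable_funM.
have a20 s : 0 <= a2 s by rewrite !mulr_ge0// invr_ge0 degree_ge0.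
have tonelli (h : borel X -> R) : measurable_fun setT h -> (forall z, 0 <= h z) ->
  (\int[P \x mu]_s ((a2 s)%:E * (h s.2)%:E) =
   \int[P]_(w in alive n) \int[mu]_z ((c w * \1_W (@state _ _ Y n w : borel X, z)) * h z)%:E)%E.
  move=> mh h0.
  have mf : measurable_fun setT (fun s => (a2 s)%:E * (h s.2)%:E)%E.
    apply: emeasurable_funM; apply/measurable_EFinP => //.
    exact: measurableT_comp mh measurable_snd.
  rewrite (fubini_tonelli1 _ mf) /=; last by move=> s; rewrite -EFinM lee_fin mulr_ge0.
  rewrite [RHS]integral_indicl; apply: eq_integral => w _.
  rewrite /fubini_F/= -ge0_integralZl//=; first last.
  - by move=> z _; rewrite lee_fin !mulr_ge0// invr_ge0 degree_ge0.
  - apply/measurable_EFinP; apply: measurable_funM => //.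
    apply: measurable_funM; first exact: measurable_cst.
    exact: (measurableT_comp mW2 (pair1_measurable w)).
  by apply: eq_integral => z _; rewrite -!EFinM /a2/= !mulrA.
have agree A : measurable A ->
    (\int[P]_w (a1 w * \1_A (@state _ _ Y n.+1 w : borel X))%:E =
     \int[P \x mu]_s (a2 s * \1_A s.2)%:E)%E.
  move=> mA; under [RHS]eq_integral do rewrite EFinM.
  rewrite (tonelli \1_A)//.
  transitivity (P (alive n `&` (@state _ _ Y n.+1 @^-1` A))).
    rewrite -[X in P X]setIT -integral_indic//; last first.
      apply: measurableI => //.
      by rewrite -[X in measurable X]setTI; exact: (mstate n.+1).
    by apply: eq_integral => w _; rewrite indicI.
  have [_ _ markov] := Y_markov.
  rewrite (@markov x n _ _ (@history_alive n) mA).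
  apply: eq_integral => w _; rewrite /walk_kernel [LHS]integral_indicl.
  apply: eq_integral => z _.
  by rewrite /walk_density -EFinM /c degreeE// indic_close_pairs mulrC.
have := weighted_integral_transfer ma1 a10 (mstate n.+1) ma2 a20 measurable_snd agree.
move=> /(_ (EFin \o g)) transfer.
transitivity (\int[P]_w ((a1 w)%:E * (g (@state _ _ Y n.+1 w))%:E))%E.
  rewrite [LHS]integral_indicl; apply: eq_integral => w _.
  have [Bw|Bw] := pselect (B (@state _ _ Y n.+1 w)); last by rewrite gB// !mule0.
  rewrite /a1 !indicE; congr ((nat_of_bool _)%:R%:E * _)%E.
  by apply/idP/idP; rewrite !inE; [case|split].
rewrite transfer; last 2 first.
- by have [mg _] := bg; exact/measurable_EFinP.
- by move=> t; rewrite lee_fin.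
have [mg _] := bg; rewrite (tonelli g)//.
by apply: eq_integral => w _; exact: walk_integral.
Qed.

(** Trades the steps of the walk one by one for iterations of the killed kernel;
at time [0] the walk is almost surely at [x]. *)
Lemma alive_survival x n k : (forall y, B y -> 0 < deg y) -> B x ->
  (\int[@start_at _ _ Y x]_(w in alive n) (survival mu W B k (@state _ _ Y n w))%:E =
   (survival mu W B (n + k) x)%:E)%E.
Proof.
move=> degB Bx; elim: n k => [|n IH] k.
  have bu := (bounded_measurable_survival mW mB degB k).1.
  rewrite [LHS]integral_indicl add0n.
  transitivity (\int[@start_at _ _ Y x]_w (survival mu W B k x)%:E)%E; last first.
    rewrite integral_cst// -[RHS]mule1; congr (_ * _)%E.
    exact: probability_setT.
  apply: ae_eq_integral => //.
  - apply: emeasurable_funM; apply/measurable_EFinP.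
      exact/measurable_indic/measurable_alive.
    exact: measurableT_comp bu.1 (mstate 0%N).
  have mx : measurable [set w | @state _ _ Y 0%N w = x].
    rewrite (_ : mkset _ = setT `&` (@state _ _ Y 0%N @^-1` [set x])) ?setTI//.
    rewrite -[X in measurable X]setTI; apply: (mstate 0%N) => //.
    rewrite -[X in measurable X]setCK; apply: measurableC; apply: measurable_open.
    rewrite openC; apply: compact_closed; first exact: metric_hausdorff.
    exact: compact_set1.
  have [_ start _] := Y_markov.
  exists (~` [set w | @state _ _ Y 0%N w = x]); split.
  - exact: measurableC.
  - transitivity (1 - 1 : \bar R)%E; last by rewrite subee.
    by rewrite -[X in (_ - X)%E](start x); exact: probability_setC.
  move=> w /= Nw xw; apply: Nw => _; rewrite xw.
  by rewrite indicE mem_set ?mul1e//= xw.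
rewrite markov_step//.
- rewrite addSnnS -IH; apply: eq_integral => w /[!inE] /aliveB Bw.
  by rewrite /= indicE mem_set// mul1r.
- exact: (bounded_measurable_survival mW mB degB k).1.
- exact: survival_ge0.
- by move=> y By; rewrite survival_out.
Qed.

Lemma occupation_le_mean_exit_time x N : (forall y, B y -> 0 < deg y) -> B x ->
  ((occupation mu W B N x)%:E <= mean_exit_time Y B x)%E.
Proof.
move=> degB Bx.
have P_alive n : @start_at _ _ Y x (alive n) = (survival mu W B n x)%:E.
  rewrite -(addn0 n) -(alive_survival _ _ degB Bx) addn0.
  rewrite -[X in start_at Y x X]setIT -integral_indic//; last exact: measurable_alive.
  rewrite [RHS]integral_indicl; apply: eq_integral => w _.
  have [aw|aw] := pselect (alive n w); last by rewrite indicE memNset// mul0e.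
  have Bw := aliveB aw.
  by rewrite [survival _ _ _ _ _]/(\1_B _) !indicE !mem_set// mul1e.
rewrite /mean_exit_time.
apply: (@le_trans _ _ (\int[@start_at _ _ Y x]_w (\sum_(n < N) \1_(alive n) w)%:E)%E).
  under eq_integral do rewrite -sumEFin.
  rewrite ge0_integral_sum//; last first.
    by move=> n; apply/measurable_EFinP; exact/measurable_indic/measurable_alive.
  rewrite /occupation -sumEFin; apply: lee_sum => n _.
  by rewrite -P_alive integral_indic ?setIT//; exact: measurable_alive.
apply: ge0_le_integral_nonmeasurable; first by move=> w; rewrite lee_fin sumr_ge0.
exact: sum_alive_le_exit_time.
Qed.

End markov.

(** * Asymptotics of the mean exit time *)

Section exit_time_lower_bound.
Context {R : realType} {X : pointedMetricType R}.
Context (mu : {finite_measure set (borel X) -> \bar R}).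
Context (X_compact : compact [set: X]).

(** Where [alpha] varies between [s] and [s + e], Ahlfors regularity bounds the
ratio of the degrees below by a multiple of [r `^ e], so that the variational
bound only loses a factor [r `^ (2 * e)] against [r `^ (- 2)]. *)
Lemma max_mean_exit_time_ge (Y : process X) (r : R) (Y_markov : markov_chain (walk_kernel mu r) Y)
    x0 (rho C s e : R) (alpha : X -> R) :
  0 < rho -> 0 < C -> 0 < r <= 1 ->
  (0 < mu (ball x0 (rho / 2) : set (borel X)))%E ->
  (forall x, ball x0 rho x -> s <= alpha x <= s + e) ->
  (forall x, ((C^-1)%:E * mu (ball x r) <= (r `^ alpha x)%:E)%E /\
             ((r `^ alpha x)%:E <= C%:E * mu (ball x r))%E) ->
  (((rho * fine (mu (ball x0 (rho / 2))) / (4 * C ^+ 2 * fine (mu (ball x0 rho)))) ^+ 2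
     * r `^ (2 * e - 2))%:E <= max_mean_exit_time Y (ball x0 rho))%E.
Proof.
move=> rho0 C0 /andP[r0 r1] muH osc ahlfors.
set B := ball x0 rho; set H := ball x0 (rho / 2).
set W : set (borel X * borel X) := close_pairs r.
have mW : measurable W by exact: measurable_close_pairs.
have HB : H `<=` B by apply: ball_sub_ball; rewrite mdistxx; lra.
have mB : measurable (B : set (borel X)) by exact: measurable_metric_ball.
have mH : measurable (H : set (borel X)) by exact: measurable_metric_ball.
have Bx0 : B x0 by rewrite /B ballEmdist/= mdistxx.
have fin (A : set (borel X)) : measurable A -> mu A = (fine (mu A))%:E.
  by move=> mA; rewrite fineK// fin_num_measure.
have ahl x : degree mu W x <= C * r `^ alpha x /\ r `^ alpha x <= C * degree mu W x.
  have := ahlfors x; rewrite degreeE//.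
  rewrite (fin _ (measurable_metric_ball x r)) -!EFinM !lee_fin => -[].
  by rewrite ler_pdivrMl.
have deg0 x : 0 < degree mu W x.
  have [_ h] := ahl x; have : 0 < r `^ alpha x by rewrite powR_gt0.
  by move=> /lt_le_trans/(_ h); rewrite pmulr_rgt0.
have degK x : B x -> 0 < degree mu W x <= C * r `^ s.
  move=> /osc/andP[sx _]; rewrite deg0/=; have [h _] := ahl x.
  by rewrite (le_trans h)// ler_pM2l// ger_powR ?r0.
have degk x : H x -> C^-1 * r `^ (s + e) <= degree mu W x.
  move=> /HB/osc/andP[_ xs]; have [_ h] := ahl x.
  by rewrite ler_pdivrMl// (le_trans _ h)// ger_powR ?r0.
have occ N x : B x -> ((occupation mu W B N x)%:E <= max_mean_exit_time Y B)%E.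
  move=> Bx; apply: (@le_trans _ _ (mean_exit_time Y B x)).
    by apply: (occupation_le_mean_exit_time X_compact Y_markov mB) => // y _.
  by apply: ereal_sup_ubound; exists x.
have occ1 : occupation mu W B 1 x0 = 1.
  by rewrite /occupation big_ord_recl big_ord0 /= indicE mem_set// addr0.
have := occ 1%N x0 Bx0; rewrite occ1.
(* -oo is excluded by the time spent at the starting point *)
case: (max_mean_exit_time Y B) occ => [M occ|_ _|_ //]; last exact: leey.
rewrite !lee_fin => M1.
have M0 : 0 < M by rewrite (lt_le_trans ltr01).
set P := r `^ s; set Q := r `^ e.
have P0 : 0 < P by rewrite powR_gt0.
have rne : r != 0 by rewrite gt_eqF.
have PQ : r `^ (s + e) = P * Q by rewrite powRD// rne implybT.
have Q2 : r `^ (2 * e - 2) = Q ^+ 2 / r ^+ 2.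
  rewrite powRB ?rne ?implybT// (_ : 2 * e = e + e); last by ring.
  by rewrite powRD ?rne ?implybT// -expr2 powR_mulrn// ltW.
have k0 : 0 < C^-1 * r `^ (s + e) by rewrite mulr_gt0 ?invr_gt0// powR_gt0.
have := @ball_occupation_energy_bound R X mu X_compact r x0 rho _ _ M r0 rho0 k0 M0 degK degk muH.
rewrite -/B -/H -/W -/P PQ => /(_ (fun N x Bx => occ N x Bx)).
have h0 : 0 < fine (mu H) by rewrite fine_gt0// muH ltey_eq fin_num_measure.
have b0 : 0 < fine (mu B).
  rewrite (lt_le_trans h0)// fine_le ?fin_num_measure//.
  by rewrite le_measure// inE.
rewrite Q2 => bound.
rewrite (_ : _ * _ = (rho / 2 * (C^-1 * (P * Q)) * fine (mu H)) ^+ 2 /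
    (4 * r ^+ 2 * (C * P * fine (mu B)) ^+ 2)); last first.
  by field; rewrite !gt_eqF.
rewrite ler_pdivrMr; first by rewrite (le_trans bound)// le_eqVlt; apply/orP; left; apply/eqP; ring.
by rewrite !mulr_gt0// exprn_gt0// !mulr_gt0.
Qed.

End exit_time_lower_bound.

Section asymptotics.
Context {R : realType}.

Lemma limf_esup_right_pinfty (F : R -> \bar R) :
  (forall A : R, \forall r \near 0^'+, (A%:E <= F r)%E) -> limf_esup F 0^'+ = +oo%E.
Proof.
move=> FA; rewrite limf_esupE.
suff h V : (0^'+ : set_system R) V -> ereal_sup (F @` V) = +oo%E.
  by apply/ereal_inf_pinfty => _ [V /h -> <-].
move=> V0; apply/eqyP => A A0.
have [r [Vr Ar]] := filter_ex (filterI V0 (FA A)).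
by apply: le_trans Ar _; apply: ereal_sup_ubound; exists r.
Qed.

Lemma powR_neg_near_pinfty (c a A : R) : 0 < c -> 0 < a ->
  \forall r \near 0^'+, A <= c * r `^ (- a).
Proof.
move=> c0 a0; have [A0|A0] := leP A 0.
  near=> r; rewrite (le_trans A0)// mulr_ge0 ?powR_ge0// ltW//.
have t0 : 0 < (c / A) `^ a^-1 by rewrite powR_gt0 // divr_gt0.
near=> r.
have r0 : 0 < r by near: r; exact: nbhs_right_gt.
have rt : r <= (c / A) `^ a^-1 by near: r; exact: nbhs_right_le.
have ra : r `^ a <= c / A.
  rewrite (le_trans (ge0_ler_powR (ltW a0) _ _ rt)) ?nnegrE ?powR_ge0 ?(ltW r0)//.
  by rewrite -powRrM mulVf ?gt_eqF// powRr1// divr_ge0// ltW.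
by rewrite powRN ler_pdivlMr ?powR_gt0// mulrC -ler_pdivlMr.
Unshelve. all: by end_near. Qed.

End asymptotics.

(** A neighbourhood witnessing the bound at [y] witnesses it at each of its
points. *)
Lemma local_dim_usc (R : realType) (X : pointedMetricType R) (y : X) (t : \bar R) :
  (local_dim y < t)%E -> exists2 U, open_nbhs y U & forall z, U z -> (local_dim z < t)%E.
Proof.
move=> /ereal_inf_lt[_ [U [oU Uy] <-] Ut]; exists U => // z Uz.
by apply: le_lt_trans Ut; apply: ereal_inf_lbound; exists U.
Qed.

Lemma local_dim_ge0 (R : realType) (X : pointedMetricType R) (y : X) :
  (0 <= local_dim y)%E.
Proof.
apply: le_ereal_inf_tmp => _ [U _ <-]; apply: le_ereal_inf_tmp => _ [s [s0 _] <-].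
by rewrite lee_fin ltW.
Qed.

(** Near a point [y] where [alpha] is within [e] of its infimum [s] over
[ball x rho], upper semicontinuity keeps [alpha] below [s + e]. *)
Lemma small_oscillation_ball (R : realType) (X : pointedMetricType R)
    (alpha : X -> R) (alphaE : forall x, (alpha x)%:E = local_dim x)
    (x : X) (rho e : R) : 0 < rho -> 0 < e ->
  exists y rho' s, [/\ 0 < rho', ball y rho' `<=` ball x rho &
    forall z, ball y rho' z -> s <= alpha z <= s + e].
Proof.
move=> rho0 e0; set B := ball x rho.
have Bx : B x by exact: ballxx.
have lbA : lbound (alpha @` B) 0.
  by move=> _ [z _ <-]; rewrite -lee_fin alphaE local_dim_ge0.
have hi : has_inf (alpha @` B) by split; [exists (alpha x), x | exists 0].
have [_ [y By <-] ys] := inf_adherent e0 hi.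
set s := inf _ in ys.
have := @local_dim_usc _ _ y (s + e)%:E; rewrite -alphaE lte_fin => /(_ ys)[U [oU Uy] Ut].
have : nbhs y (U `&` B).
  apply: filterI; first exact: open_nbhs_nbhs.
  by apply: open_nbhs_nbhs; split => //; exact: open_metric_ball.
move=> /nbhs_ballP[rho' rho'0 sub]; exists y, rho', s; split => //.
  by move=> z /sub[].
move=> z /sub[Uz Bz]; apply/andP; split.
  by apply: ge_inf; [exists 0 | exists z].
by rewrite ltW// -lte_fin alphaE Ut.
Qed.

Local Open Scope ereal_scope.

Theorem theorem7p7 (R : realType) (X : pointedMetricType R)
    (mu : {finite_measure set (borel X) -> \bar R})
    (mu_full : full_support mu)
    (X_connected : connected [set: X]) (X_compact : compact [set: X])
    (X_nontrivial : exists x y : X, x <> y)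
    (alpha : X -> R) (alphaE : forall x, (alpha x)%:E = local_dim x)
    (mu_regular : variable_ahlfors_regular mu alpha)
    (Y : R -> process X)
    (Y_markov : forall r : R, (0 < r)%R -> markov_chain (walk_kernel mu r) (Y r)) :
  forall x : X, 2%:E <= local_time_exponent Y x.
Proof.
move=> x; apply: le_ereal_inf_tmp => _ [rho /= rho0 <-].
set B := ball x rho.
suff h (e : R) : (0 < e < 1)%R -> (2 - e)%:E <= time_exponent Y B.
  apply/lee_addgt0Pr => e e0; pose e' := Num.min e (2^-1 : R)%R.
  have e'0 : (0 < e')%R by rewrite lt_min e0 invr_gt0 ltr0n.
  have e'1 : (e' < 1)%R by rewrite gt_min invf_lt1 ?ltr0n// ltr1n orbT.
  apply: (@le_trans _ _ (time_exponent Y B + e'%:E)).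
    by rewrite -leeBlDr// -EFinB h// e'0.
  by rewrite leeD2l// lee_fin ge_min lexx.
move=> /andP[e0 e1].
have [_ _ [C C1 ahlfors]] := mu_regular.
have e40 : (0 < e / 4)%R by rewrite divr_gt0.
have [y [rho' [s [rho'0 BB osc]]]] := small_oscillation_ball alphaE x rho0 e40.
have [a [b /eqP ab]] := X_nontrivial.
have ab0 : (0 < mdist a b)%R by rewrite mdist_gt0.
have C0 : (0 < C)%R by rewrite (lt_trans ltr01).
have ballpos c t : (0 < t)%R -> 0 < mu (ball c t : set (borel X)).
  move=> t0; apply: mu_full; first exact: open_metric_ball.
  by exists c; exact: ballxx.
have finepos c t : (0 < t)%R -> (0 < fine (mu (ball c t : set (borel X))))%R.
  move=> t0; rewrite fine_gt0// ballpos//= ltey_eq fin_num_measure//.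
  exact: measurable_metric_ball.
(* an oscillation of e / 4 leaves the exponent 2 (e / 4) - 2 + (2 - e) < 0 *)
apply: ereal_sup_ubound; right; exists (2 - e)%R => //; split; first by lra.
apply: limf_esup_right_pinfty => A.
pose kappa := (rho' * fine (mu (ball y (rho' / 2))) / (4 * C ^+ 2 * fine (mu (ball y rho'))))%R.
have kappa0 : (0 < kappa)%R.
  apply: divr_gt0; rewrite ?mulr_gt0 ?exprn_gt0 ?finepos ?divr_gt0 ?ltr0n//.
near=> r.
have r0 : (0 < r)%R by near: r; exact: nbhs_right_gt.
have r1 : (r <= 1)%R by near: r; exact: nbhs_right_le.
have rab : (r <= mdist a b)%R by near: r; exact: nbhs_right_le.
have Ar : (A <= kappa ^+ 2 * r `^ (- (e / 2)))%R.
  by near: r; apply: powR_neg_near_pinfty; [exact: exprn_gt0|lra].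
have rdiam : r%:E <= diam [set: X].
  apply: (@le_trans _ _ (mdist a b)%:E); first by rewrite lee_fin.
  by apply: ereal_sup_ubound; right; exists a => //; exists b.
have half0 : (0 < rho' / 2)%R by lra.
have r01 : (0 < r <= 1)%R by rewrite r0.
have bound := max_mean_exit_time_ge X_compact (Y_markov r r0) rho'0 C0 r01
  (ballpos y _ half0) osc (fun z => ahlfors z r r0 rdiam).
apply: (@le_trans _ _ (max_mean_exit_time (Y r) (ball y rho') * (r `^ (2 - e))%:E)); last first.
  by apply: lee_wpmul2r; [rewrite lee_fin powR_ge0 | exact: le_max_mean_exit_time].
apply: (@le_trans _ _ ((kappa ^+ 2 * r `^ (2 * (e / 4) - 2))%:E * (r `^ (2 - e))%:E)); last first.
  by apply: lee_wpmul2r; [rewrite lee_fin powR_ge0 | exact: bound].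
rewrite -EFinM lee_fin -mulrA -powRD ?(gt_eqF r0) ?implybT//.
by rewrite (_ : 2 * (e / 4) - 2 + (2 - e) = - (e / 2))%R; last by field.
Unshelve. all: by end_near. Qed.
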